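(* Let $S$ be a semidomain. The following conditions are equivalent: (1) $S$ is a Noetherian Prüfer semidomain. (2) $\mathrm{Frac}(S)$, the set of all nonzero fractional ideals of $S$ with the multiplication of fractional ideals, is an abelian group. (3) $S$ is a Dedekind semidomain. (4) $S$ is Noetherian and every nonzero 2-generated ideal of $S$ is invertible. (5) Each nonzero integral ideal of $S$ is invertible.
   Context: A semiring is $(S,+,\cdot,0,1)$ where $(S,+,0)$ and $(S,\cdot,1)$ are commutative monoids, $1\neq 0$, multiplication distributes over addition, and $a\cdot 0=0$ for all $a$. A semidomain is a semiring $S$ in which $ab=ac$ with $a\neq 0$ implies $b=c$. Its semifield of fractions $K=F(S)$ is the localization of $S$ at $S-\{0\}$. An ideal of $S$ is a nonempty subset closed under addition and under multiplication by elements of $S$. $S$ is Noetherian if each ideal of $S$ is finitely generated. An ideal is 2-generated if it is generated by two (not necessarily distinct) elements. A fractional ideal of $S$ is a nonempty subset $A\subseteq K$ that is an $S$-subsemimodule of $K$ (closed under addition and multiplication by elements of $S$) such that $dA\subseteq S$ for some nonzero $d\in S$. It is integral if $A\subseteq S$; integral ideals are exactly the ideals of $S$. The product of $S$-subsemimodules $A,B$ of $K$ is $AB=\{\sum_{i=1}^n a_ib_i: a_i\in A, b_i\in B, n\in\mathbb{N}\}$. A fractional ideal $A$ is invertible if there is a fractional ideal $B$ of $S$ with $AB=S$. A Prüfer semidomain is a semidomain in which each nonzero finitely generated integral ideal is invertible. A Dedekind semidomain is a semidomain in which each nonzero fractional ideal is invertible. *)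

(* Defs.v *)
From HB Require Import structures.
From mathcomp Require Import all_boot all_algebra generic_quotient ring.
From mathcomp Require Import classical_sets cardinality.

Set Implicit Arguments.
Unset Strict Implicit.
Unset Printing Implicit Defensive.

Import GRing.Theory.
Local Open Scope ring_scope.

HB.mixin Record ComNzSemiRing_isSemidomain S of GRing.ComNzSemiRing S := {
  semidomain_cancel : forall a b c : S, a != 0 -> a * b = a * c -> b = c
}.

#[short(type="semidomainType")]
HB.structure Definition Semidomain :=
  {S of ComNzSemiRing_isSemidomain S & GRing.ComNzSemiRing S}.

(* The library's {fraction R} is restricted to rings; the same construction is
   carried out here without subtraction.  By cancellation, the relation
   "a * d = b * c" on pairs (a, b) and (c, d) agrees with the general
   localization relation "s * (a * d) = s * (b * c) for some s != 0". *)
Section Semifraction.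
Variable S : semidomainType.

Lemma semidomain_mulfI (a : S) : a != 0 -> injective ( *%R a).
Proof. by move=> a0 b c; exact: semidomain_cancel. Qed.

Lemma semidomain_mulf_neq0 (a b : S) : a != 0 -> b != 0 -> a * b != 0.
Proof.
move=> a0; apply: contra_neq => ab0.
by apply: (semidomain_mulfI a0); rewrite mulr0.
Qed.

Inductive sratio := MkSratio { sfrac :> S * S; _ : sfrac.2 != 0 }.
HB.instance Definition _ := [isSub for sfrac].
HB.instance Definition _ := [Choice of sratio by <:].

Lemma sratio_den_neq0 (x : sratio) : x.2 != 0. Proof. by case: x. Qed.

Definition sratio_eqv (x y : sratio) := x.1 * y.2 == x.2 * y.1.

Lemma sratio_eqv_refl : reflexive sratio_eqv.
Proof. by move=> x; rewrite /sratio_eqv mulrC. Qed.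

Lemma sratio_eqv_sym : symmetric sratio_eqv.
Proof.
by move=> x y; rewrite /sratio_eqv eq_sym mulrC [x.1 * _]mulrC.
Qed.

Lemma sratio_eqv_trans : transitive sratio_eqv.
Proof.
move=> y x z /eqP xy /eqP yz; apply/eqP.
apply: (semidomain_mulfI (sratio_den_neq0 y)).
by rewrite mulrA [y.2 * x.1]mulrC xy -mulrA yz mulrCA.
Qed.

Canonical sratio_equiv :=
  EquivRel sratio_eqv sratio_eqv_refl sratio_eqv_sym sratio_eqv_trans.

Definition semifrac := {eq_quot sratio_eqv}%qT.

HB.instance Definition _ : EqQuotient _ sratio_eqv semifrac :=
  EqQuotient.on semifrac.
HB.instance Definition _ := Choice.on semifrac.

Lemma mulden_neq0 (x y : sratio) : x.2 * y.2 != 0.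
Proof. by rewrite semidomain_mulf_neq0 ?sratio_den_neq0. Qed.

Definition sratio_of (a : S) : sratio := @MkSratio (a, 1) (oner_neq0 S).
Definition sratio_add (x y : sratio) : sratio :=
  @MkSratio (x.1 * y.2 + y.1 * x.2, x.2 * y.2) (mulden_neq0 x y).
Definition sratio_mul (x y : sratio) : sratio :=
  @MkSratio (x.1 * y.1, x.2 * y.2) (mulden_neq0 x y).

Definition sf (x : sratio) : semifrac := (\pi_semifrac x)%qT.

Lemma sf_eqP (x y : sratio) : reflect (sf x = sf y) (x.1 * y.2 == x.2 * y.1).
Proof. exact: eqmodP. Qed.

Lemma sf_repr (u : semifrac) : sf (repr u) = u. Proof. exact: reprK. Qed.

Lemma sfW (P : semifrac -> Prop) : (forall x, P (sf x)) -> forall u, P u.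
Proof. by move=> Psf u; rewrite -[u]sf_repr. Qed.

Definition semifrac_add (u v : semifrac) := sf (sratio_add (repr u) (repr v)).
Definition semifrac_mul (u v : semifrac) := sf (sratio_mul (repr u) (repr v)).
Definition tosemifrac (a : S) : semifrac := sf (sratio_of a).

Lemma semifrac_addE x y : semifrac_add (sf x) (sf y) = sf (sratio_add x y).
Proof.
rewrite /semifrac_add.
have /sf_eqP/eqP xE := sf_repr (sf x); have /sf_eqP/eqP yE := sf_repr (sf y).
apply/sf_eqP/eqP => /=; move: (repr (sf x)) (repr (sf y)) xE yE => x' y' xE yE.
transitivity ((x'.1 * x.2) * (y'.2 * y.2) + (y'.1 * y.2) * (x'.2 * x.2)).
  by ring.
by rewrite xE yE; ring.
Qed.

Lemma semifrac_mulE x y : semifrac_mul (sf x) (sf y) = sf (sratio_mul x y).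
Proof.
rewrite /semifrac_mul.
have /sf_eqP/eqP xE := sf_repr (sf x); have /sf_eqP/eqP yE := sf_repr (sf y).
by apply/sf_eqP/eqP => /=; rewrite mulrACA xE yE mulrACA.
Qed.

Let semifracE := (semifrac_addE, semifrac_mulE).

Lemma semifrac_addA : associative semifrac_add.
Proof.
elim/sfW=> x; elim/sfW=> y; elim/sfW=> z; rewrite !semifracE.
by apply/sf_eqP/eqP => /=; ring.
Qed.

Lemma semifrac_addC : commutative semifrac_add.
Proof.
elim/sfW=> x; elim/sfW=> y; rewrite !semifracE.
by apply/sf_eqP/eqP => /=; ring.
Qed.

Lemma semifrac_add0 : left_id (tosemifrac 0) semifrac_add.
Proof.
by elim/sfW=> x; rewrite semifracE; apply/sf_eqP/eqP => /=; ring.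
Qed.

Lemma semifrac_mulA : associative semifrac_mul.
Proof.
elim/sfW=> x; elim/sfW=> y; elim/sfW=> z; rewrite !semifracE.
by apply/sf_eqP/eqP => /=; ring.
Qed.

Lemma semifrac_mulC : commutative semifrac_mul.
Proof.
elim/sfW=> x; elim/sfW=> y; rewrite !semifracE.
by apply/sf_eqP/eqP => /=; ring.
Qed.

Lemma semifrac_mul1 : left_id (tosemifrac 1) semifrac_mul.
Proof.
by elim/sfW=> x; rewrite semifracE; apply/sf_eqP/eqP => /=; ring.
Qed.

Lemma semifrac_mulDl : left_distributive semifrac_mul semifrac_add.
Proof.
elim/sfW=> x; elim/sfW=> y; elim/sfW=> z; rewrite !semifracE.
by apply/sf_eqP/eqP => /=; ring.
Qed.

Lemma semifrac_mul0 : left_zero (tosemifrac 0) semifrac_mul.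
Proof.
by elim/sfW=> x; rewrite semifracE; apply/sf_eqP/eqP => /=; ring.
Qed.

Lemma tosemifrac_inj : injective tosemifrac.
Proof. by move=> a b /sf_eqP/eqP /=; rewrite mulr1 mul1r. Qed.

Lemma semifrac_1_neq0 : tosemifrac 1 != tosemifrac 0.
Proof. by rewrite (inj_eq tosemifrac_inj) oner_neq0. Qed.

HB.instance Definition _ := GRing.isNmodule.Build semifrac
  semifrac_addA semifrac_addC semifrac_add0.
HB.instance Definition _ := GRing.Nmodule_isComNzSemiRing.Build semifrac
  semifrac_mulA semifrac_mulC semifrac_mul1 semifrac_mulDl semifrac_mul0
  semifrac_1_neq0.

Lemma tosemifrac_nmod_morphism : nmod_morphism tosemifrac.
Proof.
split=> // a b; rewrite [RHS]semifracE.
by apply/sf_eqP/eqP => /=; ring.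
Qed.

HB.instance Definition _ := GRing.isNmodMorphism.Build S semifrac tosemifrac
  tosemifrac_nmod_morphism.

Lemma tosemifrac_monoid_morphism : monoid_morphism tosemifrac.
Proof.
split=> // a b; rewrite [RHS]semifracE.
by apply/sf_eqP/eqP => /=; ring.
Qed.

HB.instance Definition _ := GRing.isMonoidMorphism.Build S semifrac tosemifrac
  tosemifrac_monoid_morphism.

Lemma tosemifrac_eq0 (a : S) : (tosemifrac a == 0) = (a == 0).
Proof. exact: (inj_eq tosemifrac_inj). Qed.

Lemma semifrac_inv (u : semifrac) : u != 0 -> exists v, u * v = 1.
Proof.
elim/sfW: u => x x0.
have n0 : x.1 != 0.
  by apply: contra_neq x0 => n0; apply/sf_eqP; rewrite /= n0 mul0r mulr0.
exists (sf (@MkSratio (x.2, x.1) n0)); rewrite [LHS]semifracE.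
by apply/sf_eqP/eqP => /=; ring.
Qed.

Lemma semifracP (u : semifrac) :
  exists a b : S, b != 0 /\ u * tosemifrac b = tosemifrac a.
Proof.
elim/sfW: u => x; exists x.1, x.2; split; first exact: sratio_den_neq0.
by rewrite [LHS]semifracE; apply/sf_eqP/eqP => /=; ring.
Qed.

End Semifraction.

Local Open Scope classical_set_scope.

Section Ideals.
Variable S : semidomainType.
Implicit Types (I X : set S) (A B : set (semifrac S)).

Definition is_ideal I :=
  [/\ I !=set0,
      (forall x y, I x -> I y -> I (x + y)) &
      (forall s x, I x -> I (s * x))].

Definition ideal_gen X : set S := smallest is_ideal X.

Definition finitely_generated I := exists2 X, finite_set X & I = ideal_gen X.

Definition two_generated I := exists a b, I = ideal_gen [set a; b].

Definition noetherian := forall I, is_ideal I -> finitely_generated I.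

Definition is_subsemimodule A :=
  [/\ A !=set0,
      (forall x y, A x -> A y -> A (x + y)) &
      (forall s x, A x -> A (tosemifrac s * x))].

Definition fractional_ideal A :=
  is_subsemimodule A /\
  exists2 d : S, d != 0 &
    forall x, A x -> range (@tosemifrac S) (tosemifrac d * x).

Definition integral_ideal A :=
  fractional_ideal A /\ A `<=` range (@tosemifrac S).

Definition semimodule_mul A B : set (semifrac S) :=
  [set x | exists n (a b : 'I_n -> semifrac S),
     [/\ forall i, A (a i), forall i, B (b i) & x = \sum_(i < n) a i * b i]].

Definition invertible A :=
  exists2 B, fractional_ideal B & semimodule_mul A B = range (@tosemifrac S).

(* Justifies passing from an ideal I of S to the integral ideal
   tosemifrac @` I in the definitions below. *)
Lemma integral_idealP A :
  integral_ideal A <-> exists2 I, is_ideal I & A = @tosemifrac S @` I.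
Proof.
split=> [[[[[x Ax] AD AM] _] AS]|[I [[x Ix] ID IM] ->]].
  exists (@tosemifrac S @^-1` A).
    split; first by have [a _ ax] := AS _ Ax; exists a; rewrite /= ax.
      by move=> a b Aa Ab; rewrite /= rmorphD; exact: AD.
    by move=> s a Aa; rewrite /= rmorphM; exact: AM.
  apply/seteqP; split=> [y Ay|_ [a Aa <-]//].
  by have [a _ ay] := AS _ Ay; exists a; rewrite //= ay.
split; last by move=> _ [a _ <-]; exists a.
split.
  split; first by exists (tosemifrac x), x.
    move=> _ _ [a Ia <-] [b Ib <-].
    by exists (a + b); rewrite ?rmorphD //; exact: ID.
  by move=> s _ [a Ia <-]; exists (s * a); rewrite ?rmorphM //; exact: IM.
exists 1; first exact: oner_neq0.
by move=> _ [a _ <-]; exists a; rewrite // rmorph1 mul1r.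
Qed.

Definition prufer := forall I,
  is_ideal I -> I <> [set 0] -> finitely_generated I ->
  invertible (@tosemifrac S @` I).

Definition dedekind := forall A,
  fractional_ideal A -> A <> [set 0] -> invertible A.

Definition Frac : set (set (semifrac S)) :=
  [set A | fractional_ideal A /\ A <> [set 0]].

End Ideals.

Definition abelian_group_on (T : Type) (G : set T) (op : T -> T -> T) :=
  [/\ (forall x y, G x -> G y -> G (op x y)),
      (forall x y z, G x -> G y -> G z -> op x (op y z) = op (op x y) z),
      (forall x y, G x -> G y -> op x y = op y x) &
      exists e, [/\ G e,
        (forall x, G x -> op e x = x) &
        (forall x, G x -> exists2 y, G y & op y x = e)]].

(* Main.v *)
(** The nonzero fractional ideals form a commutative monoid with unit [S], in
    which [A] is invertible as soon as a multiple of it is.  Invertible ideals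
    are finitely generated: if [1 = sum_i a_i b_i] with [a_i] in [A] and [b_i]
    in its inverse, then the [a_i] generate [A].  The passage from 2-generated
    to finitely generated ideals is by induction on the number of generators,
    using the identity
    [(A + B) (B + C) (C + A) = (A + B + C) (A B + B C + C A)],
    valid over semirings because the sum of semimodules is idempotent. *)
Require Import Defs.
From mathcomp Require Import all_boot all_algebra classical_sets.
From mathcomp Require Import boolp cardinality ring.

Set Implicit Arguments.
Unset Strict Implicit.
Unset Printing Implicit Defensive.

Import GRing.Theory.
Local Open Scope classical_set_scope.
Local Open Scope ring_scope.

Section FractionalIdeals.
Variable S : semidomainType.
Local Notation K := (semifrac S).
Local Notation iota := (@tosemifrac S).
Local Notation SK := (range iota).
Local Notation mul := (@semimodule_mul S).
Implicit Types (A B C M N : set K) (I X : set S).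

(** * Arithmetic of subsemimodules and fractional ideals of [K] *)

Definition semimodule_add A B : set K := [set a + b | a in A & b in B].

Lemma semifrac_mulf_neq0 (u v : K) : u != 0 -> v != 0 -> u * v != 0.
Proof.
move=> /semifrac_inv[w uw]; apply: contra_neq => uv0.
by rewrite -[v]mul1r -uw mulrAC uv0 mul0r.
Qed.

Lemma subsemimodule_range : is_subsemimodule SK.
Proof.
split; first by exists 0, 0; rewrite ?rmorph0.
  by move=> _ _ [a _ <-] [b _ <-]; exists (a + b); rewrite ?rmorphD.
by move=> s _ [a _ <-]; exists (s * a); rewrite ?rmorphM.
Qed.

Lemma fractional_range : fractional_ideal SK.
Proof.
split; first exact: subsemimodule_range.
by exists 1; [exact: oner_neq0|move=> x; rewrite rmorph1 mul1r].
Qed.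

Lemma range1 : SK 1. Proof. by exists 1; rewrite ?rmorph1. Qed.

Lemma subsemimodule0 A : is_subsemimodule A -> A 0.
Proof. by move=> [[x Ax] _ AM]; have := AM 0 x Ax; rewrite rmorph0 mul0r. Qed.

Lemma neq_set0P A : is_subsemimodule A ->
  A <> [set 0] <-> exists2 x, A x & x != 0.
Proof.
move=> /subsemimodule0 A0; split=> [nA|[x Ax x0] AE]; last first.
  by move: Ax x0; rewrite AE => ->; rewrite eqxx.
apply: contrapT => nx; apply: nA; apply/seteqP; split=> [x Ax|_ ->] //=.
by apply: contrapT => /eqP x0; apply: nx; exists x.
Qed.

Lemma semimodule_mul0 A B : mul A B 0.
Proof.
by exists 0%N, (fun=> 0), (fun=> 0); split=> [[]|[]|] //; rewrite big_ord0.
Qed.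

Lemma mem_semimodule_mul A B a b : A a -> B b -> mul A B (a * b).
Proof.
by move=> Aa Bb; exists 1%N, (fun=> a), (fun=> b); rewrite big_ord1.
Qed.

Lemma semimodule_mulD A B x y : mul A B x -> mul A B y -> mul A B (x + y).
Proof.
move=> [n [a [b [Aa Bb ->]]]] [m [c [d [Ac Bd ->]]]].
pose glue (f : 'I_n -> K) (g : 'I_m -> K) i :=
  match split i with inl j => f j | inr k => g k end.
exists (n + m)%N, (glue a c), (glue b d); split.
- by move=> i; rewrite /glue; case: split.
- by move=> i; rewrite /glue; case: split.
rewrite big_split_ord /=; congr (_ + _); apply: eq_bigr => i _; rewrite /glue.
  by rewrite (unsplitK (inl i)).
by rewrite (unsplitK (inr i)).
Qed.

(** The elimination principle behind nearly every inclusion out of a product. The target [C] need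
    only be an additive submonoid, so it may be a set such as that of all [x] with [a * x] in a
    given [M]. *)
Lemma semimodule_mul_min A B C : C 0 ->
  (forall x y, C x -> C y -> C (x + y)) ->
  (forall a b, A a -> B b -> C (a * b)) -> mul A B `<=` C.
Proof.
move=> C0 CD CM _ [n [a [b [Aa Bb ->]]]].
by apply: (big_ind C) => // i _; exact: CM.
Qed.

Lemma semimodule_mulC A B : mul A B = mul B A.
Proof.
have sub M N : mul M N `<=` mul N M.
  apply: semimodule_mul_min; first exact: semimodule_mul0.
    exact: semimodule_mulD.
  by move=> a b Ma Nb; rewrite mulrC; exact: mem_semimodule_mul.
by apply/seteqP; split; exact: sub.
Qed.

Lemma semimodule_mul3_min A B C M : M 0 ->
  (forall x y, M x -> M y -> M (x + y)) ->
  (forall a b c, A a -> B b -> C c -> M (a * (b * c))) ->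
  mul A (mul B C) `<=` M.
Proof.
move=> M0 MD MM; apply: semimodule_mul_min => // a x Aa; move: x.
apply: (@semimodule_mul_min B C (fun x => M (a * x))); first by rewrite mulr0.
  by move=> x y Mx My; rewrite mulrDr; exact: MD.
by move=> b c Bb Cc; exact: MM.
Qed.

Lemma semimodule_mulA A B C : mul A (mul B C) = mul (mul A B) C.
Proof.
have sub A' B' C' : mul A' (mul B' C') `<=` mul (mul A' B') C'.
  apply: semimodule_mul3_min; first exact: semimodule_mul0.
    exact: semimodule_mulD.
  by move=> a b c Aa Bb Cc; rewrite mulrA; do 2?apply: mem_semimodule_mul.
apply/seteqP; split; first exact: sub.
(* By commutativity the reverse inclusion is [sub] for the triple [C], [B], [A]. *)
rewrite semimodule_mulC [mul A B]semimodule_mulC [mul B C]semimodule_mulC.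
by rewrite [mul A _]semimodule_mulC; exact: sub.
Qed.

Lemma semimodule_mul1 A : is_subsemimodule A -> mul SK A = A.
Proof.
move=> AS; have A0 := subsemimodule0 AS; have [_ AD AM] := AS.
apply/seteqP; split=> [|x Ax]; last first.
  by rewrite -[x]mul1r; apply: mem_semimodule_mul => //; exact: range1.
by apply: semimodule_mul_min => // _ b [a _ <-]; exact: AM.
Qed.

Lemma subsemimodule_mul A B : is_subsemimodule A -> is_subsemimodule B ->
  is_subsemimodule (mul A B).
Proof.
move=> AS BS; split; first by exists 0; exact: semimodule_mul0.
  exact: semimodule_mulD.
(* Since [A] equals [mul SK A], associativity turns the product into [mul SK (mul A B)], which
   visibly contains [iota s * x]. *)
move=> s x ABx; rewrite -(semimodule_mul1 AS) -semimodule_mulA.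
by apply: mem_semimodule_mul => //; exists s.
Qed.

Lemma subsemimodule_add A B : is_subsemimodule A -> is_subsemimodule B ->
  is_subsemimodule (semimodule_add A B).
Proof.
move=> [[a Aa] AD AM] [[b Bb] BD BM]; split.
- by exists (a + b); exists a => //; exists b.
- move=> _ _ [x Ax [y By <-]] [z Az [t Bt <-]]; rewrite addrACA.
  by exists (x + z); [exact: AD|exists (y + t); [exact: BD|]].
move=> s _ [x Ax [y By <-]]; rewrite mulrDr.
by exists (iota s * x); [exact: AM|exists (iota s * y); [exact: BM|]].
Qed.

Lemma fractional_mul A B : fractional_ideal A -> fractional_ideal B ->
  fractional_ideal (mul A B).
Proof.
move=> [AS [d d0 dA]] [BS [e e0 eB]]; split; first exact: subsemimodule_mul.
exists (d * e); first exact: semidomain_mulf_neq0.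
have [_ SD _] := subsemimodule_range.
apply: (@semimodule_mul_min A B (fun x => SK (iota (d * e) * x))).
- by rewrite mulr0; exact: subsemimodule0 subsemimodule_range.
- by move=> x y; rewrite mulrDr; exact: SD.
move=> a b /dA[a' _ aE] /eB[b' _ bE]; exists (a' * b') => //.
by rewrite !rmorphM /= aE bE mulrACA.
Qed.

Lemma fractional_add A B : fractional_ideal A -> fractional_ideal B ->
  fractional_ideal (semimodule_add A B).
Proof.
move=> [AS [d d0 dA]] [BS [e e0 eB]]; split; first exact: subsemimodule_add.
exists (d * e); first exact: semidomain_mulf_neq0.
move=> _ [a /dA[a' _ aE] [b /eB[b' _ bE] <-]]; exists (e * a' + d * b') => //.
by rewrite rmorphD !rmorphM /= aE bE; ring.
Qed.

Lemma semimodule_mul_neq_set0 A B : is_subsemimodule A -> is_subsemimodule B ->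
  A <> [set 0] -> B <> [set 0] -> mul A B <> [set 0].
Proof.
move=> AS BS /(neq_set0P AS)[a Aa a0] /(neq_set0P BS)[b Bb b0].
apply/(neq_set0P (subsemimodule_mul AS BS)); exists (a * b).
  exact: mem_semimodule_mul.
exact: semifrac_mulf_neq0.
Qed.

Lemma range_neq_set0 : SK <> [set 0].
Proof.
apply/(neq_set0P subsemimodule_range).
by exists 1; [exact: range1|exact: oner_neq0].
Qed.

(** * Invertibility of products and of their factors *)

Lemma invertible_mul A B : fractional_ideal A -> fractional_ideal B ->
  invertible A -> invertible B -> invertible (mul A B).
Proof.
move=> Af Bf [A' A'f AA'] [B' B'f BB']; exists (mul A' B').
  exact: fractional_mul.
rewrite semimodule_mulA -[mul (mul A B) A']semimodule_mulA.
rewrite [mul B A']semimodule_mulC semimodule_mulA AA' -semimodule_mulA BB'.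
exact: (semimodule_mul1 subsemimodule_range).
Qed.

(** If [C] inverts the product, then [mul B C] inverts [A]. *)
Lemma invertible_mull A B : fractional_ideal B ->
  invertible (mul A B) -> invertible A.
Proof.
move=> Bf [C Cf ABC]; exists (mul B C); first exact: fractional_mul.
by rewrite semimodule_mulA.
Qed.

(** * Principal fractional ideals and clearing of denominators *)

Definition principal (u : K) : set K := [set iota s * u | s in setT].

Lemma principal_fractional u : fractional_ideal (principal u).
Proof.
split.
  split; first by exists (iota 0 * u); exists 0.
    move=> _ _ [s _ <-] [t _ <-]; exists (s + t) => //.
    by rewrite rmorphD mulrDl.
  by move=> s _ [t _ <-]; exists (s * t) => //; rewrite rmorphM mulrA.
(* A denominator of [u] is a common denominator of all its multiples. *)
have [a [b [b0 ub]]] := semifracP u; exists b => //.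
move=> _ [s _ <-]; exists (s * a) => //.
by rewrite rmorphM /= -ub; ring.
Qed.

Lemma principal_id u : principal u u.
Proof. by exists 1; rewrite // rmorph1 mul1r. Qed.

(** With [d] a common denominator of [A], the product of [A] with the principal ideal of [d] is
    integral and nonzero, hence invertible, and so is its factor [A]. *)
Lemma dedekind_of_integral :
  (forall A, integral_ideal A -> A <> [set 0] -> invertible A) -> dedekind S.
Proof.
move=> inv A Af nA; have [AS [d d0 dA]] := Af.
have [_ SD SM] := subsemimodule_range.
have Df := principal_fractional (iota d).
apply: (invertible_mull Df); apply: inv.
  split; first exact: fractional_mul.
  apply: semimodule_mul_min => // a _ Aa [s _ <-].
  by rewrite mulrC -mulrA; apply: SM; exact: dA.
apply: semimodule_mul_neq_set0 => //; first by case: Df.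
apply/(neq_set0P Df.1); exists (iota d); first exact: principal_id.
by rewrite tosemifrac_eq0.
Qed.

(** * Ideals of [S], and the Noetherian property from invertibility *)

Lemma ideal_fractional I : is_ideal I -> fractional_ideal (iota @` I).
Proof.
by move=> II; have [] : integral_ideal (iota @` I)
  by apply/integral_idealP; exists I.
Qed.

Lemma image_neq_set0 I : I <> [set 0] <-> iota @` I <> [set 0].
Proof.
split=> nI IE; apply: nI; last by rewrite IE image_set1 rmorph0.
apply/seteqP; split=> [x Ix|_ ->].
  have : (iota @` I) (iota x) by exists x.
  by rewrite IE => /= /eqP; rewrite tosemifrac_eq0 => /eqP.
have : (iota @` I) 0 by rewrite IE.
by move=> [x Ix /eqP]; rewrite tosemifrac_eq0 => /eqP <-.
Qed.

Lemma ideal_gen_ideal X : is_ideal (ideal_gen X).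
Proof.
split.
- exists 0 => J /= [[[x Jx] _ JM] _].
  by have := JM 0 x Jx; rewrite mul0r.
- move=> x y Ix Iy J /= JX; have [[_ JD _] _] := JX.
  by apply: JD; [exact: Ix|exact: Iy].
move=> s x Ix J /= JX; have [[_ _ JM] _] := JX.
by apply: JM; exact: Ix.
Qed.

Lemma noetherian_of_integral :
  (forall A, integral_ideal A -> A <> [set 0] -> invertible A) -> noetherian S.
Proof.
(* The zero ideal is outside the reach of [inv]; being finite, it serves as its own generating
   set. *)
move=> inv I II; have [IE|nI] := pselect (I = [set 0]).
  exists I; first by rewrite IE; exact: finite_set1.
  by apply/seteqP; split; [exact: sub_gen_smallest|exact: smallest_sub].
have [||B Bf IB] := inv (iota @` I); first by apply/integral_idealP; exists I.
  exact/image_neq_set0.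
have [n [a [b [Ia Bb abE]]]] : mul (iota @` I) B 1 by rewrite IB; exact: range1.
(* The [a i] are pulled back to [S]; [X] is finite because [iota] is injective. *)
pose X := iota @^-1` range a.
exists X.
  apply: finite_preimage; first by move=> x y _ _; exact: tosemifrac_inj.
  exact: finite_image.
have JI := ideal_gen_ideal X.
have [JS _] := ideal_fractional JI; have [_ JD JM] := JS.
apply/seteqP; split=> [x Ix|]; last first.
  apply: smallest_sub => // x [i _ aE].
  have [y Iy yE] := Ia i.
  by rewrite (@tosemifrac_inj _ x y) // yE aE.
suff [y Jy yE] : (iota @` ideal_gen X) (iota x) by rewrite -(tosemifrac_inj yE).
rewrite -[iota x]mulr1 abE big_distrr /=.
apply: (big_ind (iota @` ideal_gen X)) => //; first exact: subsemimodule0.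
move=> i _.
(* In [x = sum_i (x * b i) * a i] each coefficient [x * b i] lies in the product of [I] and [B],
   which is [S]. *)
have [s _ sE] : SK (iota x * b i).
  by rewrite -IB; apply: mem_semimodule_mul => //; exists x.
rewrite [a i * b i]mulrC mulrA -sE; apply: JM.
have [y Iy yE] := Ia i; exists y => //.
by apply: sub_gen_smallest; exists i.
Qed.

(** * Sums of subsemimodules and the three-term product identity *)

Lemma semimodule_addC A B : semimodule_add A B = semimodule_add B A.
Proof.
by apply/seteqP; split=> _ [x Ax [y By <-]]; exists y => //;
  exists x => //; rewrite addrC.
Qed.

Lemma semimodule_add_subl A B : B 0 -> A `<=` semimodule_add A B.
Proof. by move=> B0 a Aa; exists a => //; exists 0; rewrite ?addr0. Qed.

Lemma semimodule_add_subr A B : A 0 -> B `<=` semimodule_add A B.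
Proof. by rewrite semimodule_addC; exact: semimodule_add_subl. Qed.

Lemma semimodule_mulDl_min A B C M : (forall x y, M x -> M y -> M (x + y)) ->
  M 0 -> mul A C `<=` M -> mul B C `<=` M -> mul (semimodule_add A B) C `<=` M.
Proof.
move=> MD M0 AC BC; apply: semimodule_mul_min => // _ c [a Aa [b Bb <-]] Cc.
by rewrite mulrDl; apply: MD; [apply: AC|apply: BC]; exact: mem_semimodule_mul.
Qed.

Lemma semimodule_mulDr_min A B C M : (forall x y, M x -> M y -> M (x + y)) ->
  M 0 -> mul C A `<=` M -> mul C B `<=` M -> mul C (semimodule_add A B) `<=` M.
Proof.
by rewrite ![mul C _]semimodule_mulC; exact: semimodule_mulDl_min.
Qed.

(** Both sides are compared monomial by monomial: a monomial may occur several times on one side,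
    but repetitions do not matter for sums of subsemimodules. *)
Lemma semimodule_mul_add3 A B C :
  is_subsemimodule A -> is_subsemimodule B -> is_subsemimodule C ->
  mul (semimodule_add A (semimodule_add B C))
      (semimodule_add (mul A B) (semimodule_add (mul B C) (mul C A))) =
  mul (semimodule_add A B) (mul (semimodule_add B C) (semimodule_add C A)).
Proof.
move=> AS BS CS.
have A0 := subsemimodule0 AS; have B0 := subsemimodule0 BS.
have C0 := subsemimodule0 CS.
set X := semimodule_add A B; set Y := semimodule_add B C.
set Z := semimodule_add C A; set J := mul X _.
have JD := @semimodule_mulD X (mul Y Z) : forall x y, J x -> J y -> J (x + y).
have J0 : J 0 := semimodule_mul0 _ _.
have XA := semimodule_add_subl B0 : A `<=` X.
have XB := semimodule_add_subr A0 : B `<=` X.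
have YB := semimodule_add_subl C0 : B `<=` Y.
have YC := semimodule_add_subr B0 : C `<=` Y.
have ZC := semimodule_add_subl A0 : C `<=` Z.
have ZA := semimodule_add_subr C0 : A `<=` Z.
have JM x y z : X x -> Y y -> Z z -> J (x * (y * z)).
  by move=> *; apply: mem_semimodule_mul => //; exact: mem_semimodule_mul.
set I := semimodule_add A Y; set M := semimodule_add (mul A B) _.
have Y0 : Y 0 by exact: YB.
have IA := semimodule_add_subl Y0 : A `<=` I.
have IY := semimodule_add_subr A0 : Y `<=` I.
have MAB : mul A B `<=` M.
  apply: semimodule_add_subl; apply: semimodule_add_subl;
  exact: semimodule_mul0.
have sM : semimodule_add (mul B C) (mul C A) `<=` M.
  by apply: semimodule_add_subr; exact: semimodule_mul0.
have MBC : mul B C `<=` M.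
  apply: subset_trans sM; apply: semimodule_add_subl; exact: semimodule_mul0.
have MCA : mul C A `<=` M.
  apply: subset_trans sM; apply: semimodule_add_subr; exact: semimodule_mul0.
apply/seteqP; split.
  (* Distributing leaves nine cases: [A], [B], [C] in turn against [mul A B], [mul B C], [mul C A].
     In each, the three factors are reordered to lie in [X], [Y], [Z] respectively. *)
  apply: semimodule_mulDl_min => //; last apply: semimodule_mulDl_min => //;
  (apply: semimodule_mulDr_min => //; last apply: semimodule_mulDr_min => //);
  apply: semimodule_mul3_min => // u v w Pu Pv Pw.
  - by rewrite (_ : _ * _ = u * (w * v)); [apply: JM; auto|ring].
  - by apply: JM; auto.
  - by apply: JM; auto.
  - by rewrite (_ : _ * _ = u * (w * v)); [apply: JM; auto|ring].
  - by apply: JM; auto.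
  - by apply: JM; auto.
  - by rewrite (_ : _ * _ = v * (w * u)); [apply: JM; auto|ring].
  - by rewrite (_ : _ * _ = v * (u * w)); [apply: JM; auto|ring].
  - by rewrite (_ : _ * _ = w * (v * u)); [apply: JM; auto|ring].
apply: semimodule_mul3_min; first exact: semimodule_mul0.
  exact: semimodule_mulD.
move=> _ _ _ [a Aa [b Bb <-]] [b' Bb' [c Cc <-]] [c' Cc' [a' Aa' <-]].
(* The eight monomials of the expansion, each bracketed as an element of [I] times an element of
   [mul A B], [mul B C] or [mul C A]. *)
rewrite (_ : _ * _ = a * (b' * c') + a' * (a * b') + c * (c' * a) + a * (c * a')
  + b * (b' * c') + b * (a' * b') + c * (b * c') + b * (c * a')); last by ring.
have IM i m : I i -> M m -> mul I M (i * m) by exact: mem_semimodule_mul.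
have [[IB IC] ab bc ca] : [/\ (B `<=` I) * (C `<=` I),
  (forall a b, A a -> B b -> M (a * b)), (forall b c, B b -> C c -> M (b * c)) &
  (forall c a, C c -> A a -> M (c * a))].
  by split; [split=> x ?; apply: IY; [exact: YB|exact: YC]|move=> *; apply: MAB|
    move=> *; apply: MBC|move=> *; apply: MCA]; exact: mem_semimodule_mul.
by do 7?[apply: semimodule_mulD]; apply: IM; auto.
Qed.

(** By the identity, the triple sum is a factor of a product of three invertible fractional
    ideals. *)
Lemma invertible_add3 A B C :
  fractional_ideal A -> fractional_ideal B -> fractional_ideal C ->
  invertible (semimodule_add A B) -> invertible (semimodule_add B C) ->
  invertible (semimodule_add C A) ->
  invertible (semimodule_add A (semimodule_add B C)).
Proof.
move=> Af Bf Cf iX iY iZ.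
apply: (@invertible_mull _
  (semimodule_add (mul A B) (semimodule_add (mul B C) (mul C A)))).
  by do 2?[apply: fractional_add]; exact: fractional_mul.
rewrite semimodule_mul_add3; [|by case: Af|by case: Bf|by case: Cf].
have [Xf Yf Zf] := And3 (fractional_add Af Bf) (fractional_add Bf Cf)
  (fractional_add Cf Af).
apply: invertible_mul => //; first exact: fractional_mul.
exact: invertible_mul.
Qed.

(** * From two generators to finitely many *)

(** The fractional ideal generated by a list, built as an iterated sum so that [invertible_add3]
    applies directly to a list with two heads. *)
Definition span (s : seq S) : set K :=
  foldr (fun a A => semimodule_add (principal (iota a)) A) [set 0] s.

Lemma span_fractional s : fractional_ideal (span s).
Proof.
elim: s => [|a s IHs] /=; last first.
  exact: fractional_add (principal_fractional _) IHs.
split.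
  split; first by exists 0.
    by move=> x y -> ->; rewrite /= addr0.
  by move=> t x ->; rewrite /= mulr0.
by exists 1; [exact: oner_neq0|move=> x ->; exists 0; rewrite // rmorph0 mulr0].
Qed.

Lemma mem_span s a : a \in s -> span s (iota a).
Proof.
elim: s => //= b s IHs; rewrite inE => /predU1P[->|/IHs sa].
  apply: semimodule_add_subl; last exact: principal_id.
  exact: subsemimodule0 (span_fractional s).1.
apply: semimodule_add_subr sa.
exact: subsemimodule0 (principal_fractional _).1.
Qed.

Lemma span_min s A : is_subsemimodule A -> (forall a, a \in s -> A (iota a)) ->
  span s `<=` A.
Proof.
move=> AS; have [_ AD AM] := AS; elim: s => [|b s IHs] /= sA.
  by move=> _ ->; exact: subsemimodule0.
move=> _ [_ [t _ <-] [x sx <-]]; apply: AD.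
  by apply: AM; apply: sA; rewrite mem_head.
by apply: IHs sx => a sa; apply: sA; rewrite inE sa orbT.
Qed.

(** The list need only contain the nonzero elements of [X], as zero generators contribute nothing;
    this allows them to be discarded later. *)
Lemma image_ideal_gen X s : (forall a, a \in s -> X a) ->
  (forall a, X a -> a != 0 -> a \in s) -> iota @` ideal_gen X = span s.
Proof.
move=> sX Xs; apply/seteqP; split; last first.
  apply: span_min => [|a /sX Xa].
    by case: (ideal_fractional (ideal_gen_ideal X)).
  by exists a => //; exact: sub_gen_smallest.
move=> _ [a Ia <-]; move: a Ia.
have [sS _] := span_fractional s; have s0 := subsemimodule0 sS.
have [_ sD sM] := sS.
apply: (@smallest_sub _ _ _ (iota @^-1` span s)).
  split; first by exists 0; rewrite /= rmorph0.
    by move=> x y sx sy; rewrite /= rmorphD; exact: sD.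
  by move=> t x sx; rewrite /= rmorphM; exact: sM.
move=> a /Xs; have [->|a0 /(_ isT)] := eqVneq a 0; first by rewrite /= rmorph0.
exact: mem_span.
Qed.

Lemma span_invertible :
  (forall a b, a != 0 -> invertible (span [:: a; b])) ->
  forall a s, a != 0 -> all (predC1 0) s -> invertible (span (a :: s)).
Proof.
move=> inv2 a s; have [n] := ubnP (size s).
have span1 b : span [:: b] = principal (iota b).
  by apply/seteqP; split=> [_ [x bx [_ -> <-]]|x bx]; rewrite ?addr0 //;
    exists x => //; exists 0; rewrite ?addr0.
elim: n => // n IHn in a s *; case: s => [_ a0 _|b s /= sn a0 /andP[b0 s0]].
  (* A single generator [a] is treated as the pair [a], [0]. *)
  have span0 : span [:: 0] = [set 0].
    rewrite span1; apply/seteqP; split=> [_ [t _ <-]|_ ->].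
      by rewrite rmorph0 mulr0.
    by exists 0; rewrite // rmorph0 mulr0.
  by rewrite /= -span0; exact: inv2.
(* The three summands come from [a], from [b] and from the tail [s]. One pairwise sum has two
   generators; the other two are spans of lists shorter by one with a nonzero head, covered by
   induction. *)
apply: invertible_add3;
  [exact: principal_fractional|exact: principal_fractional|
   exact: span_fractional|..].
- by rewrite -[principal (iota b)]span1; exact: inv2.
- exact: (IHn b s).
by rewrite semimodule_addC; exact: (IHn a s).
Qed.

Lemma prufer_of_two_generated :
  (forall I, is_ideal I -> I <> [set 0] -> two_generated I ->
     invertible (iota @` I)) -> prufer S.
Proof.
move=> inv I II nI [X /finite_seqP[s ->] IE].
have inv2 a b : a != 0 -> invertible (span [:: a; b]).
  move=> a0; rewrite -(@image_ideal_gen [set a; b]).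
  - apply: inv; [exact: ideal_gen_ideal| |by exists a, b].
    move=> abE; have : ideal_gen [set a; b] a by apply: sub_gen_smallest; left.
    by rewrite abE => /eqP; rewrite (negPf a0).
  - by move=> x; rewrite !inE => /orP[] /eqP ->; [left|right].
  by move=> x [] -> _; rewrite !inE eqxx ?orbT.
rewrite image_neq_set0 in nI; move: nI; rewrite IE.
(* Zeros are filtered out to meet the hypotheses of [span_invertible]. The filtered list is not
   empty, since its span would then be zero, against [nI]. *)
rewrite (@image_ideal_gen _ [seq x <- s | predC1 0 x]).
- have := filter_all (predC1 0) s; case: filter => [|a t] //= /andP[a0 t0] _.
  exact: span_invertible.
- by move=> a; rewrite mem_filter => /andP[].
by move=> a sa a0; rewrite mem_filter /= a0.
Qed.

(** * The group of nonzero fractional ideals *)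

Lemma abelian_group_of_dedekind :
  dedekind S -> abelian_group_on (@Frac S) (@semimodule_mul S).
Proof.
move=> inv; split.
- move=> A B [Af nA] [Bf nB]; split; first exact: fractional_mul.
  by apply: semimodule_mul_neq_set0; [case: Af|case: Bf| |].
- by move=> A B C _ _ _; exact: semimodule_mulA.
- by move=> A B _ _; exact: semimodule_mulC.
exists SK; split.
- by split; [exact: fractional_range|exact: range_neq_set0].
- by move=> A [[AS _] _]; exact: semimodule_mul1.
move=> A [Af nA]; have [B Bf AB] := inv A Af nA.
exists B; last by rewrite semimodule_mulC.
(* The inverse must itself belong to [Frac]: if it were zero, the product [SK] would be zero. *)
split=> // B0; apply: range_neq_set0; rewrite -AB B0.
apply/seteqP; split=> [|_ ->]; last exact: semimodule_mul0.
apply: semimodule_mul_min => //=; first by move=> x y -> ->; rewrite addr0.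
by move=> a b _ ->; rewrite mulr0.
Qed.

(** The abstract unit [E] has to be [SK]: their product equals [SK] because [E] is neutral, and [E]
    because [SK] acts trivially on subsemimodules. Group inverses are thus inverses in the sense of
    [invertible]. *)
Lemma dedekind_of_abelian_group :
  abelian_group_on (@Frac S) (@semimodule_mul S) -> dedekind S.
Proof.
move=> [_ _ _ [E [[[ES _] _] E1 EV]]] A Af nA.
have EE : E = SK.
  rewrite -(semimodule_mul1 ES) semimodule_mulC; apply: E1.
  by split; [exact: fractional_range|exact: range_neq_set0].
have [B [Bf _] BA] := EV A (conj Af nA).
by exists B => //; rewrite semimodule_mulC BA.
Qed.

End FractionalIdeals.

Theorem theorem3p3 (S : semidomainType) :
  [<-> noetherian S /\ prufer S;
       abelian_group_on (@Frac S) (@semimodule_mul S);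
       dedekind S;
       noetherian S /\
         (forall I : set S, is_ideal I -> I <> [set 0] -> two_generated I ->
            invertible (@tosemifrac S @` I));
       (forall A : set (semifrac S), integral_ideal A -> A <> [set 0] ->
            invertible A)].
Proof.
(* Shared by the first and fourth implications: in the Noetherian case the Prüfer condition reaches
   every nonzero integral ideal. *)
have integral_inv : noetherian S -> prufer S ->
    forall A, @integral_ideal S A -> A <> [set 0] -> invertible A.
  move=> noeth pruf _ /integral_idealP[I II ->] /image_neq_set0 nI.
  by apply: pruf => //; exact: noeth.
tfae.
- move=> [noeth pruf]; apply: abelian_group_of_dedekind.
  by apply: dedekind_of_integral; exact: integral_inv.
- exact: dedekind_of_abelian_group.
- move=> ded; split.
    by apply: noetherian_of_integral => A [Af _]; exact: ded.
  move=> I II /image_neq_set0 nI _; apply: ded => //; exact: ideal_fractional.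
- by move=> [noeth /prufer_of_two_generated]; exact: integral_inv.
move=> inv; split; first exact: noetherian_of_integral.
move=> I II /image_neq_set0 nI _; apply: inv => //.
by apply/integral_idealP; exists I.
Qed.
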